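(* Let $\mathcal{A}\in\mathbb{T}_{p,n}$ and $\mathcal{B}\in\mathbb{T}_{q,n}$. Suppose that $p$ is an even number satisfying $p>q\geq 2$ and that $\mathcal{A}$ is an ${\rm H}^+$-tensor. Then for any $b\in\mathbb{R}^n$ the solution set $${\rm SOL}(\mathcal{A},\mathcal{B},b)=\{x\in\mathbb{R}^n : \mathcal{A}x^{p-1}+\mathcal{B}|x|^{q-1}=b\}$$ is a nonempty compact set.
   Context: $\mathbb{T}_{m,n}$ is the set of real $m$-th order $n$-dimensional square tensors $\mathcal{A}=(a_{i_1i_2\ldots i_m})$, with $a_{i_1\ldots i_m}\in\mathbb{R}$, $1\le i_1,\ldots,i_m\le n$ (no symmetry assumed). For $\mathcal{A}\in\mathbb{T}_{m,n}$ and $x\in\mathbb{R}^n$, $\mathcal{A}x^{m-1}\in\mathbb{R}^n$ is the vector with components $(\mathcal{A}x^{m-1})_i=\sum_{i_2,\ldots,i_m=1}^n a_{ii_2\ldots i_m}x_{i_2}\cdots x_{i_m}$. The vector $|x|$ is the componentwise absolute value of $x$, and $\mathcal{B}|x|^{q-1}$ denotes $\mathcal{B}y^{q-1}$ with $y=|x|$. The unit tensor $\mathcal{I}\in\mathbb{T}_{p,n}$ has entries $1$ if all $p$ indices coincide and $0$ otherwise, so $(\mathcal{I}x^{p-1})_i=x_i^{p-1}$. A tensor $\mathcal{A}\in\mathbb{T}_{p,n}$ is called an ${\rm H}^+$-tensor if there exists no $(x,t)\in(\mathbb{R}^n\setminus\{\mathbf{0}\})\times\mathbb{R}_+$ such that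 $(\mathcal{A}+t\mathcal{I})x^{p-1}=\mathbf{0}$, where $\mathbb{R}_+=[0,\infty)$. *)

(* Defs.v *)
From HB Require Import structures.
From mathcomp Require Import all_boot all_order all_algebra.
From mathcomp Require Import all_classical all_reals all_analysis.

Set Implicit Arguments.
Unset Strict Implicit.
Unset Printing Implicit Defensive.

Import Order.TTheory GRing.Theory Num.Theory.
Import numFieldNormedType.Exports.

Local Open Scope classical_set_scope.
Local Open Scope ring_scope.

Notation tensor R m n := {ffun m.-tuple 'I_n -> R}.

(* A x^(m-1), for m >= 1: the i-th component sums over the multi-indices      *)
(* J = (i_1, ..., i_m) with i_1 = i, and [behead J] is (i_2, ..., i_m).       *)
Definition tensor_app (R : realType) (m n : nat) (A : tensor R m n)
    (x : 'rV[R]_n) : 'rV[R]_n :=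
  \row_i \sum_(J : m.-tuple 'I_n | ohead J == Some i)
    A J * \prod_(j <- behead J) x 0 j.

Definition unit_tensor (R : realType) (m n : nat) : tensor R m n :=
  [ffun J : m.-tuple 'I_n => (constant J)%:R].

Definition abs_vec (R : realType) (n : nat) (x : 'rV[R]_n) : 'rV[R]_n :=
  \row_i `|x 0 i|.

Definition Hplus_tensor (R : realType) (p n : nat) (A : tensor R p n) : Prop :=
  ~ exists (x : 'rV[R]_n) (t : R),
      [/\ x != 0, 0 <= t & tensor_app (A + t *: unit_tensor R p n) x = 0].

Definition SOL (R : realType) (p q n : nat) (A : tensor R p n)
    (B : tensor R q n) (b : 'rV[R]_n) : set 'rV[R]_n :=
  [set x | tensor_app A x + tensor_app B (abs_vec x) = b].

(* Main.v *)
Require Import Defs.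
From HB Require Import structures.
From mathcomp Require Import all_boot all_order all_algebra.
From mathcomp Require Import all_classical all_reals all_analysis.
From mathcomp Require Import ring lra.

(** The theorem is a Leray-Schauder argument.  Write F x for
    A x^(p-1) + B |x|^(q-1) - b and x^[p-1] for the vector of the powers
    x_i^(p-1), which is the unit tensor applied to x.  Dividing
    (A + t I) x^(p-1) by 1 + t turns the H+ hypothesis into a statement about a
    segment: (1 - s) A x^(p-1) + s x^[p-1] has no zero x <> 0 for 0 <= s <= 1,
    the value s = 1 standing for t = +oo.  By compactness of the unit sphere
    times [0, 1] and homogeneity its norm is at least c |x|^(p-1) with c > 0
    ([homotopy_bounded_below]).  Since B |x|^(q-1) - b has degree q - 1 < p - 1,
    the zeros of (1 - s) F + s x^[p-1] lie in one ball, of radius r0 say,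
    for all s in [0, 1] ([a_priori_bound]).  With s = 0 this bounds the solution
    set, which is closed, hence compact.

    For existence, suppose that F never vanishes and let r > r0.  As p - 1 is
    odd, x |-> x^[p-1] is a homeomorphism, so that there is a continuous map f
    with f(x)^[p-1] = - r^(p-1) F x / |F x|.  It maps the whole space
    into the sphere of radius r for the sup norm, so it has a fixed point x by
    Brouwer's theorem, and x is a zero of (1 - s) F + s x^[p-1] for some s
    although |x| = r > r0: a contradiction ([residual_zero]).

    Brouwer's theorem is needed only for bounded continuous maps of R^n
    ([bounded_map_fixpoint]).  It is derived from Scarf's combinatorial lemma
    ([full_room]), which plays the role of Sperner's lemma but replaces the
    triangulation by n + 1 linear orders on the points of a grid: the cells are
    the sets that no point exceeds in all the orders, and the only geometric
    fact behind the parity count is that an inner facet belongs to exactly two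
    cells ([odd_fillers]). *)

Set Implicit Arguments.
Unset Strict Implicit.
Unset Printing Implicit Defensive.

Import Order.TTheory GRing.Theory Num.Theory.
Import numFieldNormedType.Exports.

Local Open Scope classical_set_scope.
Local Open Scope ring_scope.

(** * A combinatorial lemma of Scarf *)

Section Scarf.
Local Close Scope classical_set_scope.
Local Close Scope ring_scope.
Local Open Scope nat_scope.
Local Open Scope set_scope.

Variables (I U : finType) (r : I -> U -> nat).
Hypothesis r_inj : forall i, injective (r i).

(** The linear order attached to [i] is given by its injective rank function
    [r i].  A set is dominant when no point lies strictly above it, that is,
    above its lowest element for each of the orders.  Dominant sets with [#|I|]
    elements (rooms) are the cells of an abstract triangulation; those with one
    element less (doors) are its facets. *)
Definition dominant (s : {set U}) :=
  [forall u, [exists i, [forall x in s, r i u <= r i x]]].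

Lemma dominantP (s : {set U}) :
  reflect (forall u, exists i, forall x, x \in s -> r i u <= r i x) (dominant s).
Proof.
apply: (iffP forallP) => h u; first have /existsP [i /forall_inP] := h u.
  by exists i.
by apply/existsP; have [i hi] := h u; exists i; apply/forall_inP.
Qed.

Lemma dominantS (s t : {set U}) : s \subset t -> dominant t -> dominant s.
Proof.
move=> /fintype.subsetP st /dominantP h; apply/dominantP => u; have [i hi] := h u.
by exists i => x /st; apply: hi.
Qed.

(** [x0] is any element of [t]: the minimum requires one, and its value does not
    depend on it. *)
Definition lowest (t : {set U}) (x0 : U) (i : I) : U :=
  [arg min_(x < x0 in t) r i x].

Section Lowest.
Variables (t : {set U}) (x0 : U).
Hypothesis tx0 : x0 \in t.

Lemma lowest_in i : lowest t x0 i \in t.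
Proof. by rewrite /lowest; case: arg_minnP. Qed.

Lemma lowest_le i x : x \in t -> r i (lowest t x0 i) <= r i x.
Proof. by rewrite /lowest; case: arg_minnP => // y _ h /h. Qed.

Lemma lowest_eq i x : x \in t -> (forall y, y \in t -> r i x <= r i y) ->
  lowest t x0 i = x.
Proof.
move=> xt h; apply: (@r_inj i); apply/eqP.
by rewrite eqn_leq lowest_le // h // lowest_in.
Qed.

(** Testing dominance on an element [x] of [t] itself gives an order for which
    [x] is lowest. *)
Lemma lowest_imset : dominant t -> lowest t x0 @: I = t.
Proof.
move=> /dominantP dt; apply/setP => x; apply/imsetP/idP => [[i _ ->]|xt].
  exact: lowest_in.
by have [i hi] := dt x; exists i => //; rewrite (lowest_eq xt).
Qed.

End Lowest.

(** [lowest s x0] is onto [s] by [lowest_imset], and [s] has as many elements as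
    there are orders. *)
Lemma lowest_inj (s : {set U}) x0 : x0 \in s -> dominant s -> #|s| = #|I| ->
  injective (lowest s x0).
Proof.
move=> xs ds cs; have /imset_injP h : #|lowest s x0 @: I| == #|I|.
  by rewrite lowest_imset // cs.
by move=> i j; apply: h.
Qed.

Section Door.
Variables (t : {set U}) (x0 : U).
Hypotheses (tx0 : x0 \in t) (dt : dominant t) (ct : #|t|.+1 = #|I|).
Local Notation mn := (lowest t x0).

(** [mn] maps the orders onto a set with one element less, so exactly one pair
    of orders has the same lowest element. *)
Lemma door_collision : exists i j, [/\ i != j, mn i = mn j &
  forall k l, k != l -> mn k = mn l -> (k = i /\ l = j) \/ (k = j /\ l = i)].
Proof.
have [i [j [nij eij]]] : exists i j, i != j /\ mn i = mn j.
  have : ~~ injectiveb mn.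
    apply/injectiveP => inj; have := card_imset I inj.
    by rewrite lowest_imset // => h; move: ct; rewrite -h => /eqP; rewrite eqn_leq ltnn.
  by case/injectivePn => i [j nij eij]; exists i, j; split.
have img : mn @: [set~ i] = t.
  rewrite -[RHS](lowest_imset tx0 dt); apply/setP => x.
  apply/imsetP/imsetP => [[k _ ->]|[k _ ->]]; first by exists k.
  have [->|nki] := eqVneq k i; last by exists k; rewrite // !inE.
  by exists j => //; rewrite !inE eq_sym.
have /imset_injP inj : #|mn @: [set~ i]| == #|[set~ i]|.
  by rewrite img cardsC1 -ct.
exists i, j; split => // k l nkl ekl.
have [eki|nki] := eqVneq k i; [left|right].
  split=> //; apply: inj; rewrite ?inE; [by rewrite -eki eq_sym|by rewrite eq_sym|].
  by rewrite -ekl eki.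
have [eli|nli] := eqVneq l i.
  split=> //; apply: inj; rewrite ?inE ?(eq_sym j) //.
  by rewrite ekl eli.
by case/eqP: nkl; apply: inj; rewrite ?inE.
Qed.

(** The candidates for completing the door to a room in which the new point is
    the lowest one for the order [k]. *)
Definition above k : {set U} := [set u | [forall l, (l != k) ==> (r l (mn l) < r l u)]].

Lemma aboveP k u : reflect (forall l, l != k -> r l (mn l) < r l u) (u \in above k).
Proof.
rewrite inE; apply: (iffP forallP) => h l; last by apply/implyP/h.
by move/implyP: (h l).
Qed.

Variables (i j : I).
Hypotheses (nij : i != j) (eij : mn i = mn j).

Lemma hits k x : k \in [set i; j] -> x \in t -> exists2 l, l != k & mn l = x.
Proof.
move=> kij; rewrite -{1}(lowest_imset tx0 dt) => /imsetP [l _ ->].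
have [->|nlk] := eqVneq l k; last by exists l.
move: kij; rewrite !inE => /orP [] /eqP ->.
  by exists j; rewrite // eq_sym.
by exists i.
Qed.

Lemma above_notin k u : k \in [set i; j] -> u \in above k -> u \notin t.
Proof.
move=> kij /aboveP h; apply/negP => ut.
by have [l nlk /esym eu] := hits kij ut; have := h l nlk; rewrite -eu ltnn.
Qed.

Lemma above_below k u x : u \in above k -> x \in t -> r k u <= r k x.
Proof.
move=> /aboveP h xt; have /dominantP/(_ u) [l hl] := dt.
have [elk|nlk] := eqVneq l k; first by rewrite -elk hl.
by have := h l nlk; rewrite ltnNge hl // lowest_in.
Qed.

Lemma above_disjoint : [disjoint above i & above j].
Proof.
apply/pred0P => u /=; apply/negP => /andP [ui uj].
have /dominantP/(_ u) [l hl] := dt; have := hl _ (lowest_in tx0 l).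
have [eli|nli] := eqVneq l i; rewrite leqNgt.
  by move/aboveP: uj => ->; rewrite // eli.
by move/aboveP: ui => ->.
Qed.

Definition topmost k : {set U} :=
  [set u in above k | [forall z in above k, r k z <= r k u]].

Lemma card_topmost k : #|topmost k| = (above k != finset.set0).
Proof.
have [e|/set0Pn [u0 hu0]] /= := eqVneq (above k) finset.set0.
  by apply/eqP; rewrite cards_eq0; apply/eqP/setP => u; rewrite inE e inE.
pose u := [arg max_(x > u0 in above k) r k x].
have [ua ub] : u \in above k /\ forall z, z \in above k -> r k z <= r k u.
  by rewrite /u; case: arg_maxnP.
suff -> : topmost k = [set u] by rewrite cards1.
apply/setP => v; rewrite finset.in_set1 inE; apply/andP/eqP => [[va /forall_inP vb]|->].
  by apply: (@r_inj k); apply/eqP; rewrite eqn_leq ub // vb.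
by split=> //; apply/forall_inP.
Qed.

(** Adding a point [u] to a door gives a room exactly when [u] takes over the
    role of the common lowest element for one of the two colliding orders [k].
    Among the points of [above k] it must be the highest for [k], since a higher
    one would contradict dominance.  There is thus at most one completion for
    each of [i], [j]. *)
Lemma fillers_topmost :
  [set u | (u \notin t) && dominant (u |: t)] = topmost i :|: topmost j.
Proof.
apply/setP => u; rewrite [LHS]inE; apply/andP/setUP => [[ut ds]|].
  have us : u \in u |: t by rewrite setU11.
  have cs : #|u |: t| = #|I| by rewrite cardsU1 ut add1n ct.
  have inj := lowest_inj us ds cs.
  have st x : x \in t -> x \in u |: t by move=> xt; rewrite inE xt orbT.
  have lowt k : lowest (u |: t) u k \in t -> lowest (u |: t) u k = mn k.
    by move=> h; apply/esym/lowest_eq => // y /st; apply: lowest_le.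
  have : u \in lowest (u |: t) u @: I by rewrite lowest_imset.
  case/imsetP => k _ eku.
  have lt l : l != k -> lowest (u |: t) u l \in t.
    move=> nlk; have := lowest_in us l; rewrite in_setU1 => /orP [/eqP h|//].
    by case/eqP: nlk; apply: inj; rewrite h.
  have kij : k = i \/ k = j.
    have [->|ki] := eqVneq k i; first by left.
    have [->|kj] := eqVneq k j; first by right.
    case/eqP: nij; apply: inj.
    rewrite eq_sym in ki; rewrite eq_sym in kj.
    by rewrite (lowt _ (lt _ ki)) (lowt _ (lt _ kj)) eij.
  have ua : u \in above k.
    apply/aboveP => l nlk; rewrite -(lowt l (lt l nlk)) ltn_neqAle.
    rewrite lowest_le // andbT (inj_eq (@r_inj _)).
    by apply/eqP => h; have := lt l nlk; rewrite h (negbTE ut).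
  have ub : u \in topmost k.
    rewrite inE ua; apply/forall_inP => z /aboveP za.
    have /dominantP/(_ z) [l hl] := ds.
    have [elk|nlk] := eqVneq l k; first by rewrite -elk hl.
    by have := za l nlk; rewrite ltnNge hl // st // lowest_in.
  by case: kij => <-; [left|right].
suff main k : k \in [set i; j] -> u \in topmost k -> u \notin t /\ dominant (u |: t).
  by case; apply: main; rewrite !inE eqxx ?orbT.
move=> kij; rewrite inE => /andP [ua /forall_inP ub].
split; first exact: above_notin ua.
apply/dominantP => z; have [za|/aboveP] := boolP (z \in above k).
  exists k => x; rewrite in_setU1 => /orP [/eqP -> |xt]; first exact: ub.
  exact: (above_below za).
move=> /existsNP [l] /not_implyP [nlk] /negP; rewrite -leqNgt => hz.
exists l => x; rewrite in_setU1 => /orP [/eqP -> |xt].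
  by rewrite (leq_trans hz) // ltnW //; apply/aboveP: nlk.
by rewrite (leq_trans hz) // lowest_le.
Qed.

End Door.

(** The slack points bound the configuration: the slack point of [i] is lowest
    for the order [i] and lies above all the proper points for the others.  They
    stand for the faces of the simplex, so that no boundary condition on the
    colouring has to be imposed. *)
Variable slack : I -> U.
Hypothesis slack_inj : injective slack.
Hypothesis slack_min : forall i u, r i (slack i) <= r i u.
Hypothesis slack_max : forall i j u,
  j != i -> u \notin codom slack -> r i u < r i (slack j).

(** The outer doors: they play the part of the faces of the boundary, which belong
    to a single cell. *)
Definition facet a : {set U} := slack @: [set~ a].

Lemma card_facet a : #|facet a|.+1 = #|I|.
Proof. by rewrite card_imset // cardsC1 prednK //; apply/card_gt0P; exists a. Qed.

Lemma facetP a u : reflect (exists2 h, h != a & u = slack h) (u \in facet a).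
Proof.
apply: (iffP imsetP) => -[h]; first by rewrite !inE => ? ->; exists h.
by move=> ? ->; exists h; rewrite // !inE.
Qed.

Lemma dominant_facet a : dominant (facet a).
Proof.
apply/dominantP => u; have [/codomP [h ->]|nu] := boolP (u \in codom slack).
  by exists h.
by exists a => x /facetP [h nha ->]; rewrite ltnW // slack_max.
Qed.

(** If the slack point of [k] is not above [t] for some order [l <> k], then
    every point of [t] ranks, for [l], at least as high as a slack point other
    than the lowest one.  Hence [t] consists of slack points, that of [l]
    excepted. *)
Lemma slack_above (t : {set U}) x0 k : x0 \in t -> #|t|.+1 = #|I| ->
  (forall a, t != facet a) -> slack k \in above t x0 k.
Proof.
move=> tx0 ct nf; apply/aboveP => l nlk; rewrite ltnNge; apply/negP => le.
have le' x : x \in t -> r l (slack k) <= r l x.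
  by move=> xt; rewrite (leq_trans le) // lowest_le.
case/negP: (nf l); rewrite eqEcard -ltnS card_facet ct leqnn andbT.
apply/fintype.subsetP => x xt; have [/codomP [h exh]|nx] := boolP (x \in codom slack).
  apply/facetP; exists h => //; apply: contra_neq nlk => ehl.
  apply: slack_inj; apply: (@r_inj l); apply/eqP.
  by rewrite eqn_leq slack_min /=; have := le' x xt; rewrite exh ehl.
by have := slack_max (_ : k != l) nx; rewrite eq_sym nlk ltnNge le' // => /(_ isT).
Qed.

(** An inner door lies in two rooms, because both candidate sets contain a slack
    point.  For the outer door of [a] the colliding orders are [a] and some [b],
    and nothing is above it for [b], so that it lies in one room. *)
Lemma odd_fillers (t : {set U}) : 1 < #|I| -> dominant t -> #|t|.+1 = #|I| ->
  odd #|[set u | (u \notin t) && dominant (u |: t)]| = [exists a, t == facet a].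
Proof.
move=> I_gt1 dt ct.
have [x0 tx0] : exists x0, x0 \in t by apply/card_gt0P; move: I_gt1; rewrite -ct.
have [i [j [nij eij ijP]]] := door_collision tx0 dt ct.
rewrite (fillers_topmost tx0 dt ct nij eij).
have -> : #|topmost t x0 i :|: topmost t x0 j| =
    (above t x0 i != finset.set0) + (above t x0 j != finset.set0).
  rewrite -!card_topmost; apply/eqP; rewrite (leq_card_setU _ _).2.
  have := above_disjoint tx0 dt nij; apply: disjointW;
    by apply/fintype.subsetP => u; rewrite inE => /andP [].
have [/existsP [a /eqP eta]|/existsPn nf] := boolP [exists a, t == facet a]; last first.
  have ne k : above t x0 k != finset.set0.
    by apply/set0Pn; exists (slack k); apply: slack_above.
  by rewrite !ne.
have mnE l : l != a -> lowest t x0 l = slack l.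
  by move=> nla; apply: lowest_eq => //; rewrite eta; apply/facetP; exists l.
have [b nba eb] : exists2 b, b != a & lowest t x0 a = slack b.
  by apply/facetP; rewrite -eta lowest_in.
have ha : above t x0 a != finset.set0.
  apply/set0Pn; exists (slack a); apply/aboveP => l nla.
  rewrite mnE // ltn_neqAle slack_min andbT; apply: contra_neq nla.
  by move=> /r_inj/slack_inj.
have hb : above t x0 b == finset.set0.
  apply/set0Pn => -[u /aboveP hu].
  have := hu a; rewrite eq_sym nba eb => /(_ isT).
  have [/codomP [h eu]|nu] := boolP (u \in codom slack); last first.
    by rewrite ltnNge ltnW // slack_max.
  rewrite {}eu in hu *; have [->|nha] := eqVneq h a.
    by rewrite ltnNge slack_min.
  have [->|nhb] := eqVneq h b; first by rewrite ltnn.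
  by move=> _; have := hu h nhb; rewrite (mnE h nha) ltnn.
have [] := ijP b a nba; first by rewrite mnE.
  by case=> <- <-; rewrite ha (eqP hb) eqxx.
by case=> <- <-; rewrite ha (eqP hb) eqxx.
Qed.

Variable c : U -> I.
Hypothesis c_slack : forall i, c (slack i) = i.

(** The parity step of Sperner's lemma: a fully coloured set has exactly one
    facet with all the colours but [i0].  If another set has such a facet it has
    two, obtained by dropping either of its two elements of the same colour. *)
Lemma odd_nearly_full (i0 : I) (s : {set U}) : #|s| = #|I| ->
  odd #|[set x in s | c @: (s :\ x) == [set~ i0]]| = (c @: s == finset.setT).
Proof.
move=> cs; have [full|nfull] := boolP (c @: s == finset.setT).
  have /imset_injP inj : #|c @: s| == #|s| by rewrite (eqP full) cardsT cs.
  have : i0 \in c @: s by rewrite (eqP full) finset.in_setT.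
  case/imsetP => x xs ex.
  suff -> : [set x in s | c @: (s :\ x) == [set~ i0]] = [set x] by rewrite cards1.
  apply/setP => y; rewrite inE finset.in_set1; apply/andP/eqP => [[ys /eqP ey]|->].
    apply: (inj) => //; rewrite -ex; apply/eqP; apply: contraT => nc.
    have : c y \in [set~ i0] by rewrite !inE.
    rewrite -ey => /imsetP [z]; rewrite !inE => /andP [nzy zs] eyz.
    by case/eqP: nzy; apply: (inj).
  split=> //; apply/eqP/setP => k; rewrite !inE; apply/imsetP/idP.
    case=> z; rewrite !inE => /andP [nzx zs] ->; rewrite ex.
    by apply: contra_neq nzx; apply: (inj).
  move=> nk; have : k \in c @: s by rewrite (eqP full) finset.in_setT.
  case/imsetP => z zs ek; exists z => //; rewrite !inE zs andbT.
  by apply: contra_neq nk => ezx; rewrite ek ezx.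
have [->|/set0Pn [x]] := eqVneq [set x in s | c @: (s :\ x) == [set~ i0]] finset.set0.
  by rewrite cards0.
rewrite inE => /andP [xs /eqP ex].
have /imset_injP inj : #|c @: (s :\ x)| == #|s :\ x|.
  by rewrite ex cardsC1; move: cs; rewrite (cardsD1 x) xs => <-.
have nx : c x != i0.
  apply: contra nfull => /eqP cx; apply/eqP/setP => k; rewrite finset.in_setT.
  have [->|nk] := eqVneq k i0; first by apply/imsetP; exists x.
  have : k \in [set~ i0] by rewrite !inE.
  by rewrite -ex; apply/fintype.subsetP/imsetS/finset.subD1set.
have : c x \in [set~ i0] by rewrite !inE.
rewrite -{1}ex => /imsetP [x']; rewrite !inE => /andP [nx'x x's] exx'.
suff -> : [set x in s | c @: (s :\ x) == [set~ i0]] = [set x; x'].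
  by rewrite cards2 eq_sym nx'x.
apply/setP => y; rewrite inE !inE; apply/andP/orP => [[ys /eqP ey]|].
  have [->|nyx] := eqVneq y x; [by left|right].
  have : c y \in [set~ i0].
    by rewrite -ex; apply/imsetP; exists y; rewrite // !inE nyx.
  rewrite -ey => /imsetP [z]; rewrite !inE => /andP [nzy zs] eyz.
  have [ezx|nzx] := eqVneq z x; last first.
    by case/eqP: nzy; apply: (inj); rewrite ?inE ?nzx ?nyx.
  by apply/eqP; apply: (inj); rewrite ?inE ?nyx ?nx'x // eyz ezx.
case=> /eqP ->; first by rewrite xs ex.
split=> //; rewrite -ex; apply/eqP/setP => k; apply/imsetP/imsetP => -[z].
  rewrite !inE => /andP [nz zs] ->.
  have [->|nzx] := eqVneq z x; [exists x'|exists z]; by rewrite // !inE ?nx'x ?nzx.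
rewrite !inE => /andP [nz zs] ->.
have [->|nzx] := eqVneq z x'; [exists x|exists z];
  by rewrite // !inE ?nzx // eq_sym nx'x.
Qed.

Lemma odd_sum (J : finType) (F : J -> nat) :
  odd (\sum_j F j) = \big[addb/false]_j odd (F j).
Proof. exact: (big_morph odd oddD). Qed.

Lemma imset_c_facet a : c @: facet a = [set~ a].
Proof.
apply/setP => k; rewrite !inE; apply/imsetP/idP.
  by case=> u /facetP [h nha ->] ->; rewrite c_slack.
by move=> nka; exists (slack k); rewrite ?c_slack //; apply/facetP; exists k.
Qed.

(** Scarf's lemma.  Count modulo 2 the pairs formed by a room and one of its
    doors that has all the colours but [i0].  By doors, only outer doors matter,
    and the slack colouring leaves exactly one of these; by rooms, only fully
    coloured ones matter.  Their number is therefore odd. *)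
Lemma full_room : 1 < #|I| ->
  exists s : {set U}, [/\ dominant s, #|s| = #|I| & c @: s = finset.setT].
Proof.
move=> I_gt1; have [i0 _] : exists i0, i0 \in I by apply/card_gt0P; rewrite ltnW.
pose door (t : {set U}) := (#|t|.+1 == #|I|) && (c @: t == [set~ i0]).
pose incident x (t : {set U}) := [&& x \notin t, dominant (x |: t) & door t].
have by_doors : odd (\sum_x \sum_t incident x t).
  rewrite exchange_big odd_sum /= (bigD1 (facet i0)) //=.
  have odd_t t : odd (\sum_x incident x t) = (t == facet i0).
    have [/andP [/eqP ct /eqP cit]|ndt] := boolP (door t); last first.
      rewrite big1 => [|x _]; last by rewrite /incident (negbTE ndt) !andbF.
      apply/esym/negbTE; apply: contra ndt => /eqP ->.
      by rewrite /door card_facet imset_c_facet !eqxx.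
    have [dt|ndt] := boolP (dominant t); last first.
      rewrite big1 => [|x _].
        by apply/esym/negbTE; apply: contra ndt => /eqP ->; exact: dominant_facet.
      rewrite /incident; case: (boolP (dominant _)) => [d|_]; last by rewrite andbF.
      by case/negP: ndt; apply: dominantS d; apply: finset.subsetUr.
    transitivity (odd #|[set u | (u \notin t) && dominant (u |: t)]|).
      rewrite -[in RHS]sum1_card [in RHS]big_mkcond /=; congr odd; apply: eq_bigr => x _.
      by rewrite inE /incident /door ct cit !eqxx !andbT; case: ifP.
    rewrite odd_fillers //; apply/existsP/eqP => [[a /eqP eta]|->]; last by exists i0.
    suff -> : i0 = a by [].
    by apply/eqP; move: cit; rewrite eta imset_c_facet => /finset.setC_inj
      /finset.set1_inj ->.
  by rewrite odd_t eqxx big1 // => t /negbTE; rewrite odd_t.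
have by_rooms x : \sum_t incident x t =
    \sum_(s : {set U}) [&& x \in s, dominant s, #|s| == #|I| & c @: (s :\ x) == [set~ i0]].
  transitivity (\sum_(t : {set U} | x \notin t) incident x t).
    rewrite [RHS]big_mkcond; apply: eq_bigr => t _.
    by rewrite /incident; case: (x \notin t).
  rewrite (reindex_onto (fun s : {set U} => s :\ x) (fun t => x |: t)) /=; last first.
    by move=> t xt; rewrite finset.setU1K.
  rewrite big_mkcond; apply: eq_bigr => s _; rewrite !inE eqxx /=.
  have [xs|nxs] := boolP (x \in s); last first.
    by rewrite ifN //; apply: contra nxs => /eqP <-; rewrite setU11.
  rewrite finset.setD1K // eqxx /incident /door finset.setD1K // !inE eqxx /=.
  by rewrite (cardsD1 x s) xs.
have : [exists s, [&& dominant s, #|s| == #|I| & c @: s == finset.setT]].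
  apply: contraT => /existsPn none; move: by_doors.
  rewrite (eq_bigr _ (fun x _ => by_rooms x)) exchange_big odd_sum big1 // => s _.
  have [/andP [ds /eqP cs]|nds] := boolP (dominant s && (#|s| == #|I|)); last first.
    by rewrite big1 // => x _; case: (x \in s); rewrite //= andbA (negbTE nds).
  transitivity (odd #|[set x in s | c @: (s :\ x) == [set~ i0]]|).
    rewrite -[in RHS]sum1_card [in RHS]big_mkcond /=; congr odd; apply: eq_bigr => x _.
    by rewrite inE ds cs eqxx /=; case: ifP.
  by rewrite odd_nearly_full //; apply: negbTE; have := none s; rewrite ds cs eqxx.
by case/existsP => s /and3P [ds /eqP cs /eqP fs]; exists s.
Qed.

End Scarf.

(** * Colourings of the grid points of a simplex *)

Section Grid.
Local Close Scope classical_set_scope.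
Local Close Scope ring_scope.
Local Open Scope nat_scope.
Local Open Scope set_scope.

Variables n m : nat.
Local Notation index := 'I_n.+1.

Definition grid := {z : {ffun index -> 'I_m.+1} | \sum_i (z i : nat) == m}.

Definition coordinates (z : grid) : index -> nat := fun i => val z i.

Lemma sum_coordinates z : \sum_i coordinates z i = m.
Proof. exact/eqP/(valP z). Qed.

Lemma coordinates_onto (v : index -> nat) : \sum_i v i = m ->
  exists z, coordinates z =1 v.
Proof.
move=> sv; have lev i : v i < m.+1 by rewrite ltnS -sv (bigD1 i) //= leq_addr.
pose z := [ffun i => Ordinal (lev i)].
have sz : \sum_i (z i : nat) == m.
  by rewrite -[X in _ == X]sv; apply/eqP/eq_bigr => i _; rewrite ffunE.
by exists (exist _ z sz) => i; rewrite /coordinates /= ffunE.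
Qed.

(** Grid points are ordered by their [i]-th coordinate, ties being broken by an
    arbitrary enumeration; [inl j] is the slack point of [j]. *)
Definition grid_rank (i : index) (u : index + grid) : nat :=
  match u with
  | inl j => if j == i then 0 else (m.+1 * #|{: grid}| + j).+1
  | inr z => (coordinates z i * #|{: grid}| + enum_rank z).+1
  end.

Lemma grid_rank_coord i y z :
  grid_rank i (inr y) <= grid_rank i (inr z) -> coordinates y i <= coordinates z i.
Proof.
have K_gt0 : 0 < #|{: grid}| by apply/card_gt0P; exists y.
rewrite /= ltnS => /(leq_div2r #|{: grid}|); rewrite !divnMDl //.
by rewrite !divn_small ?addn0.
Qed.

Lemma grid_rank_lt_slack i j z : j != i -> grid_rank i (inr z) < grid_rank i (inl j).
Proof.
move=> /negbTE /= ->; rewrite ltnS.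
apply: leq_trans (leq_addr _ _); rewrite mulSnr -addnS leq_add //.
by rewrite leq_mul2r leq_ord orbT.
Qed.

Lemma grid_rank_inj i : injective (grid_rank i).
Proof.
move=> [j|y] [k|z].
- rewrite /=; have [->|_] := eqVneq j i; have [->|_] := eqVneq k i => //.
  by move=> [] /addnI /val_inj ->.
- have [->|nji] := eqVneq j i; first by rewrite /= eqxx.
  by move=> e; have := grid_rank_lt_slack z nji; rewrite e ltnn.
- have [->|nki] := eqVneq k i; first by rewrite /= eqxx.
  by move=> e; have := grid_rank_lt_slack y nki; rewrite e ltnn.
move=> [] /(congr1 (modn^~ #|{: grid}|)).
by rewrite !modnMDl !modn_small // => /val_inj/enum_rank_inj ->.
Qed.

(** The discrete form of Brouwer's theorem.  [w] collects, for each [i] whose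
    slack point is missing from a fully coloured room, the least [i]-th
    coordinate in that room, and 0 for the other [i].  Dominance bounds the sum
    of [w] from below: if it were less than [m - n], some grid point would exceed
    [w] strictly in all coordinates.  The points of the room then stay within [n]
    of [w]. *)
Lemma grid_labelling (c : (index -> nat) -> index) : 0 < n ->
  exists w : index -> nat, [/\ \sum_i w i <= m, m <= \sum_i w i + n &
    forall j, w j = 0 \/ exists v, [/\ \sum_i v i = m, c v = j &
      forall i, w i <= v i <= w i + n]].
Proof.
move=> n_gt0.
pose color (u : index + grid) :=
  match u with inl j => j | inr z => c (coordinates z) end.
have [s [/dominantP ds _ fs]] : exists s : {set index + grid},
    [/\ dominant grid_rank s, #|s| = #|{: index}| & color @: s = finset.setT].
  apply: (@full_room _ _ grid_rank grid_rank_inj (@inl index grid)) => //.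
  - by move=> i j [].
  - by move=> i u; rewrite /= eqxx.
  - move=> i j [k|z] nji; first by rewrite codom_f.
    by move=> _; apply: grid_rank_lt_slack.
  - by rewrite card_ord ltnS.
have real_dominant y : exists i, inl i \notin s /\
    forall z, inr z \in s -> coordinates y i <= coordinates z i.
  have [i hi] := ds (inr y); exists i; split.
    by apply/negP => /hi; rewrite /= eqxx.
  by move=> z /hi /grid_rank_coord.
have colored j : inl j \notin s -> exists2 z, inr z \in s & c (coordinates z) = j.
  move=> njs; have : j \in color @: s by rewrite fs finset.in_setT.
  case/imsetP => -[k|z] us /= ej; last by exists z.
  by rewrite ej us in njs.
have [y0 _] : exists z, coordinates z =1 (fun i => m * (i == ord0)).
  apply: coordinates_onto; rewrite (bigD1 ord0) //= muln1 big1 ?addn0 // => i.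
  by move=> /negbTE ->; rewrite muln0.
have [z0 z0s] : exists z0, inr z0 \in s.
  by have [i [/colored [z0 z0s _] _]] := real_dominant y0; exists z0.
pose lowest_coord j := [arg min_(z < z0 | inr z \in s) coordinates z j].
pose w j := if inl j \in s then 0 else coordinates (lowest_coord j) j.
have w_le z j : inr z \in s -> w j <= coordinates z j.
  by rewrite /w /lowest_coord; case: ifP => // _; case: arg_minnP => // y _ h /h.
have sum_w : m <= \sum_i w i + n.
  rewrite leqNgt; apply/negP => lt.
  (* [w + 1] has coordinate sum at most [m]; what is missing may be added to any
     coordinate. *)
  pose excess := m - (\sum_i w i + n.+1).
  have [y hy] : exists y, coordinates y =1 (fun i => w i + 1 + excess * (i == ord0)).
    apply: coordinates_onto; rewrite !big_split /= sum_nat_const card_ord muln1.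
    rewrite [X in _ + X](bigD1 ord0) //= muln1 [X in _ + (_ + X)]big1; last first.
      by move=> i /negbTE ->; rewrite muln0.
    by rewrite addn0 subnKC // addnS.
  have [i [nis hi]] := real_dominant y.
  have : coordinates y i <= w i.
    by rewrite /w (negbTE nis) /lowest_coord; case: arg_minnP => // z /hi.
  by rewrite hy -addnA addnA addn1 ltnNge leq_addr.
exists w; split=> //.
  by rewrite -(sum_coordinates z0); apply: leq_sum => i _; apply: w_le.
move=> j; have [js|/colored [z zs cz]] := boolP (inl j \in s).
  by left; rewrite /w js.
right; exists (coordinates z); split=> // [|i]; first exact: sum_coordinates.
rewrite w_le //= -(leq_add2r (\sum_(k | k != i) w k)).
apply: (@leq_trans (\sum_k coordinates z k)).
  by rewrite [leqRHS](bigD1 i) //= leq_add2l; apply: leq_sum => k _; apply: w_le.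
by rewrite sum_coordinates (leq_trans sum_w) // (bigD1 i) //= addnAC.
Qed.

End Grid.

(** * Continuity of maps between row vectors *)

Lemma continuous_coord (R : realType) (T : topologicalType) n
    (g : T -> 'rV[R]_n) z j :
  {for z, continuous g} -> {for z, continuous (fun v => g v 0 j)}.
Proof.
move=> gz; apply: (@continuous_comp _ _ _ g (fun w : 'rV[R]_n => w 0 j)) => //.
exact: coord_continuous.
Qed.

Lemma continuous_row (R : realType) (T : topologicalType) n
    (g : T -> 'rV[R]_n) z :
  (forall j, {for z, continuous (fun v => g v 0 j)}) -> {for z, continuous g}.
Proof.
move=> gz A [P zP PA]; rewrite /nbhs /=.
suff : \forall v \near z, forall ij : 'I_1 * 'I_n, P ij.1 ij.2 (g v ij.1 ij.2).
  by apply: filterS => v vP; apply: PA => i j; apply: (vP (i, j)).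
apply: filter_forall => -[i j] /=; rewrite (ord1 i).
by apply: gz; rewrite -(ord1 i); apply: zP.
Qed.

Lemma continuous_sum (R : realType) (T : topologicalType) (I : Type) (r : seq I)
    (P : pred I) (F : I -> T -> R) z :
  (forall i, P i -> {for z, continuous (F i)}) ->
  {for z, continuous (fun v => \sum_(i <- r | P i) F i v)}.
Proof. by apply: cvg_big; exact: add_continuous. Qed.

Lemma continuous_prod (R : realType) (T : topologicalType) (I : Type) (r : seq I)
    (P : pred I) (F : I -> T -> R) z :
  (forall i, P i -> {for z, continuous (F i)}) ->
  {for z, continuous (fun v => \prod_(i <- r | P i) F i v)}.
Proof. by apply: cvg_big; exact: mul_continuous. Qed.

Lemma continuous_unit_coord (R : realType) (T : topologicalType) n
    (g : T -> 'rV[R]_n) (c : R) i z : {for z, continuous g} -> g z != 0 ->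
  {for z, continuous (fun v => c * g v 0 i / `|g v|)}.
Proof.
move=> cg gz; apply: cvgM.
  by apply: cvgM; [exact: cvg_cst|exact: continuous_coord].
by apply: cvgV; [rewrite normr_eq0|exact: cvg_norm].
Qed.

(** * Bounded continuous maps have fixed points *)

Section Brouwer.
Variables (R : realType) (n : nat) (f : 'rV[R]_n -> 'rV[R]_n) (M : R).
Hypotheses (n_gt0 : (0 < n)%N) (M_gt0 : 0 < M).
Hypothesis f_bounded : forall x i, `|f x 0 i| <= M.

Local Notation L := (2 * n%:R * M).
Local Notation widen := (widen_ord (leqnSn n)).

(** The simplex with vertex (-M, ..., -M) cut out by [\sum_i x 0 i <= n * M]
    contains the cube [-M, M]^n, hence the range of [f]; it has edge [L] and
    carries a grid of mesh [L / m].  Its first [n] barycentric coordinates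
    are the shifted coordinates of [x], and the last one is controlled by the
    sum.  A point receives a colour [j] whose barycentric coordinate does not
    decrease under [f]; near the grid point given by [grid_labelling] this
    happens for every [j], unless the coordinate [j] is so small there that it
    cannot decrease by more than [e]. *)
Lemma almost_fixed (e : R) : 0 < e -> exists x : 'rV[R]_n,
  [/\ forall i, - M <= x 0 i <= L - M,
      forall j, exists v : 'rV[R]_n,
        (forall i, `|v 0 i - x 0 i| <= e) /\ v 0 j <= f v 0 j &
      exists v : 'rV[R]_n,
        (forall i, `|v 0 i - x 0 i| <= e) /\
        \sum_i f v 0 i <= \sum_i v 0 i + e].
Proof.
move=> e_gt0; have n_gt0' : 0 < n%:R :> R by rewrite ltr0n.
have L_gt0 : 0 < L by rewrite !mulr_gt0.
pose m := (Num.truncn (L * n%:R / e)).+1.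
have m_gt0 : 0 < m%:R :> R by rewrite ltr0n.
have small : L * n%:R / m%:R <= e.
  by rewrite ler_pdivrMr // -ler_pdivrMl // mulrC ltW // /m truncnS_gt.
pose pt (w : 'I_n.+1 -> nat) : 'rV[R]_n := \row_i (L * (w (widen i))%:R / m%:R - M).
have pt_close w v i : (w (widen i) <= v (widen i) <= w (widen i) + n)%N ->
    `|pt v 0 i - pt w 0 i| <= e.
  move=> /andP [lo hi]; apply: le_trans small; rewrite !mxE opprB addrA subrK.
  rewrite -mulrBl -mulrBr -natrB // ger0_norm ?divr_ge0 ?mulr_ge0 ?ler0n ?(ltW M_gt0) //.
  rewrite ler_wpM2r ?invr_ge0 ?ler0n // ler_wpM2l ?(ltW L_gt0) //.
  by rewrite ler_nat leq_subLR.
pose c (w : 'I_n.+1 -> nat) : 'I_n.+1 :=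
  if [pick j | pt w 0 j <= f (pt w) 0 j] is Some j then widen j else ord_max.
have cP v j : c v = widen j -> pt v 0 j <= f (pt v) 0 j.
  rewrite /c; case: pickP => [k h /(congr1 val) /= /val_inj <- //|_].
  by move=> /(congr1 val) /= nj; have := ltn_ord j; rewrite -nj ltnn.
have cmax v : c v = ord_max -> forall j, f (pt v) 0 j <= pt v 0 j.
  rewrite /c; case: pickP => [k _ /(congr1 val) /= nk|h _ j].
    by have := ltn_ord k; rewrite nk ltnn.
  by rewrite leNgt; apply/negP => /ltW; rewrite h.
have [w [w_le w_ge wP]] := grid_labelling m c n_gt0.
exists (pt w); split.
- move=> i; rewrite mxE lerD2r -[leLHS]sub0r lerD2r -mulrA.
  rewrite mulr_ge0 ?divr_ge0 ?ler0n ?(ltW L_gt0) //= ger_pMr // ler_pdivrMr // mul1r.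
  by rewrite ler_nat (leq_trans _ w_le) // (bigD1 (widen i)) //= leq_addr.
- move=> j; have [wj|[v [_ cv vP]]] := wP (widen j); last first.
    by exists (pt v); split=> [i|]; [exact: pt_close|exact: cP].
  exists (pt w); split=> [i|]; first by rewrite subrr normr0 ltW.
  rewrite [leLHS]mxE wj mulr0 mul0r sub0r lerNl.
  by rewrite (le_trans _ (f_bounded (pt w) j)) // -normrN ler_norm.
have [wm|[v [_ cv vP]]] := wP ord_max; last first.
  exists (pt v); split=> [i|]; first exact: pt_close.
  by rewrite -[leLHS]addr0 lerD ?(ltW e_gt0) //; apply: ler_sum => i _; apply: cmax.
exists (pt w); split=> [i|]; first by rewrite subrr normr0 ltW.
have Sf : \sum_i f (pt w) 0 i <= n%:R * M.
  apply: (@le_trans _ _ (\sum_(i < n) M)); last by rewrite sumr_const card_ord mulr_natl.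
  by apply: ler_sum => i _; apply: le_trans (ler_norm _) (f_bounded _ _).
apply: le_trans Sf _.
have -> : \sum_i pt w 0 i = L * (\sum_(i < n) w (widen i))%:R / m%:R - n%:R * M.
  rewrite (eq_bigr (fun i => L / m%:R * (w (widen i))%:R - M)); last first.
    by move=> i _; rewrite mxE mulrAC.
  by rewrite sumrB sumr_const card_ord -mulr_sumr -natr_sum [n%:R * M]mulr_natl mulrAC.
move: w_ge; rewrite big_ord_recr /= wm addn0 => w_ge.
have : L <= L * (\sum_(i < n) w (widen i))%:R / m%:R + L * n%:R / m%:R.
  by rewrite -mulrDl -mulrDr ler_pdivlMr // ler_pM2l // -natrD ler_nat.
move: small; set a := L * _ / _; set b := L * _ / _; lra.
Qed.

Hypothesis f_cont : continuous f.

(** At a cluster point of almost fixed points no coordinate decreases under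
    [f] and the sum of the coordinates does not increase, so nothing changes. *)
Lemma bounded_map_fixpoint : exists x, f x = x.
Proof.
have [x xP] := choice (fun k : nat => almost_fixed (harmonic_gt0 k)).
pose K := [set v : 'rV[R]_n | forall i, `[- M, L - M]%classic (v ord0 i)].
have cK : compact K.
  apply: (@rV_compact R n (fun=> `[- M, L - M]%classic)) => i.
  exact: segment_compact.
have FK : (x @ \oo) K.
  by exists 0%N => // k _ i /=; rewrite in_itv /=; have [h _ _] := xP k; apply: h.
have [z [_ cz]] := cK _ _ FK.
(* The points [v] attached to [x k] by [almost_fixed] also accumulate at [z],
   since [harmonic k] tends to 0. *)
have frequently (P : set 'rV[R]_n) N : (\forall v \near z, P v) ->
    exists2 k, (N <= k)%N &
      forall v : 'rV[R]_n, (forall i, `|v 0 i - x k 0 i| <= harmonic k) -> P v.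
  move=> /nbhs_ballP [e /= e_gt0 zP].
  have e2_gt0 : 0 < e / 2 by rewrite divr_gt0.
  have [N0 _ hN0] := cvgr_lt _ cvg_harmonic _ e2_gt0.
  pose late := [set k | (N <= k)%N /\ @harmonic R k < e / 2].
  have [| |_ [[k [Nk ke] <-] zxk]] := cz [set x k | k in late] (ball z (e / 2)).
  - exists (maxn N N0) => // k; rewrite /= geq_max => /andP [Nk N0k].
    by exists k => //; split=> //; apply: hN0.
  - exact: nbhsx_ballx.
  exists k => // v hv; apply: zP; split=> // i j; have [_ /(_ i j)] := zxk.
  rewrite /ball /= (ord1 i) => hx.
  apply: le_lt_trans (ler_distD (x k 0 j) _ _) _; rewrite [e]splitr ltrD //.
  by rewrite distrC (le_lt_trans (hv j)).
have cont_coord j : {for z, continuous (fun v => f v 0 j - v 0 j)}.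
  apply: (@continuousB _ _ _ (fun v => f v 0 j) (fun v => v 0 j)).
    exact: (continuous_coord (@f_cont z)).
  exact: coord_continuous.
have le_coord j : z 0 j <= f z 0 j.
  rewrite leNgt; apply/negP; rewrite -subr_lt0 => lt.
  have [k _ kP] := frequently _ 0%N (cvgr_lt _ (cont_coord j) _ lt).
  have [_ /(_ j) [v [/kP /= ltv lev]] _] := xP k.
  by move: ltv; rewrite subr_lt0 ltNge lev.
have le_sum : \sum_i (f z 0 i - z 0 i) <= 0.
  rewrite leNgt; apply/negP => gt.
  have gt2 : (\sum_i (f z 0 i - z 0 i)) / 2 < \sum_i (f z 0 i - z 0 i) by lra.
  have cont_sum : {for z, continuous (fun v => \sum_i (f v 0 i - v 0 i))}.
    by apply: continuous_sum => i _; apply: cont_coord.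
  have [N _ NP] := cvgr_lt _ cvg_harmonic _ (divr_gt0 gt (ltr0n R 2)).
  have [k Nk kP] := frequently _ N (cvgr_gt _ cont_sum _ gt2).
  have [_ _ [v [/kP /= lt le]]] := xP k.
  by move: le; rewrite leNgt -ltrBrDl -sumrB (lt_trans (NP k Nk)).
exists z; apply/rowP => j; apply/eqP; rewrite -subr_eq0.
have ge0 i : 0 <= f z 0 i - z 0 i by rewrite subr_ge0.
rewrite eq_le ge0 andbT; apply: le_trans le_sum.
by rewrite (bigD1 j) //= lerDl sumr_ge0.
Qed.

End Brouwer.

(** * The odd root *)

Section OddRoot.
Variables (R : realType) (k : nat).
Hypothesis k_odd : odd k.

Definition odd_root (a : R) : R := Num.sg a * `|a| `^ k%:R^-1.

Let k_gt0 : (0 < k)%N. Proof. by case: k k_odd. Qed.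

Let sgX (a : R) : Num.sg a ^+ k = Num.sg a.
Proof.
case: sgrP => _; rewrite ?expr1n ?expr0n ?(gtn_eqF k_gt0) //.
by rewrite -signr_odd k_odd.
Qed.

Lemma odd_rootK : cancel odd_root (fun x => x ^+ k).
Proof.
move=> a; rewrite /odd_root exprMn sgX -powR_mulrn ?powR_ge0 // -powRrM.
by rewrite mulVf ?pnatr_eq0 -?lt0n // powRr1 // -numEsg.
Qed.

Lemma exprn_oddK : cancel (fun x => x ^+ k) odd_root.
Proof.
move=> x; rewrite /odd_root sgrX sgX normrX -powR_mulrn // -powRrM.
by rewrite mulfV ?pnatr_eq0 -?lt0n // powRr1 // -numEsg.
Qed.

Lemma continuous_odd_root : continuous odd_root.
Proof.
move=> a; have : {near odd_root a ^+ k, continuous odd_root}.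
  apply: (@near_can_continuous R (fun x => x ^+ k)).
    by near=> x; rewrite exprn_oddK.
  by near=> x; apply: exprn_continuous.
by move=> /nbhs_singleton; rewrite odd_rootK.
Unshelve. all: by end_near.
Qed.

Lemma odd_root_le (a r : R) : 0 <= r -> `|a| <= r ^+ k -> `|odd_root a| <= r.
Proof.
move=> r_ge0 ar; rewrite -(@ler_pXn2r _ k) ?nnegrE //.
by rewrite -normrX odd_rootK.
Qed.

End OddRoot.

(** * The sup norm of a row vector *)

Section RowNorm.
Variables (R : realType) (n : nat).
Implicit Types x : 'rV[R]_n.

Lemma norm_coord_le x i : `|x 0 i| <= `|x|.
Proof.
rewrite [leRHS]/Num.norm /= mx_normrE.
by apply/bigmax_geP; right; exists (0, i).
Qed.

Lemma row_norm_le x e : 0 <= e -> (forall i, `|x 0 i| <= e) -> `|x| <= e.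
Proof.
move=> e_ge0 xe; rewrite [leLHS]/Num.norm /= mx_normrE.
by apply/bigmax_leP; split=> // -[i j] _; rewrite (ord1 i).
Qed.

Lemma row_norm_attained x : x != 0 -> exists i, `|x 0 i| = `|x|.
Proof.
rewrite -normr_eq0 => /mx_norm_neq0 [[i j] /= xij].
by exists j; rewrite [RHS]xij (ord1 i).
Qed.

Lemma norm_abs_vec x : `|abs_vec x| = `|x|.
Proof.
apply/eqP; rewrite eq_le !row_norm_le // => i.
  by have := norm_coord_le (abs_vec x) i; rewrite mxE normr_id.
by rewrite mxE normr_id norm_coord_le.
Qed.

End RowNorm.

(** * Tensors acting on vectors *)

Section TensorApp.
Variables (R : realType) (m n : nat).
Implicit Types (A B : tensor R m n) (x : 'rV[R]_n).

Lemma tensor_appZ A c x : tensor_app A (c *: x) = c ^+ m.-1 *: tensor_app A x.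
Proof.
apply/rowP => i; rewrite !mxE mulr_sumr; apply: eq_bigr => J _.
rewrite (eq_bigr (fun j => c * x 0 j)); last by move=> j _; rewrite mxE.
rewrite big_split /= big_const_seq count_predT size_behead size_tuple iter_mulr_1.
by rewrite mulrCA.
Qed.

Lemma tensor_appD A B t x :
  tensor_app (A + t *: B) x = tensor_app A x + t *: tensor_app B x.
Proof.
apply/rowP => i; rewrite !mxE mulr_sumr -big_split /=; apply: eq_bigr => J _.
by rewrite !ffunE mulrDl mulrA.
Qed.

Lemma tensor_app_unit x : (0 < m)%N ->
  tensor_app (unit_tensor R m n) x = \row_i x 0 i ^+ m.-1.
Proof.
move=> m_gt0; apply/rowP => i; rewrite !mxE.
rewrite (bigD1 (nseq_tuple m i)) /=; last by case: m m_gt0.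
rewrite ffunE [X in _ + X]big1 => [|J /andP [hJ nJ]].
  rewrite addr0 constant_nseq mul1r; case: m m_gt0 => // k _.
  by rewrite /= big_nseq iter_mulr_1.
rewrite ffunE; suff /negbTE -> : ~~ constant J by rewrite mul0r.
apply: contra nJ => cJ; apply/eqP/val_inj => /=.
case: (tval J) (size_tuple J) hJ cJ => [|j s] /= <- //.
by move=> /eqP [->] /all_pred1P {1}->.
Qed.

Lemma tensor_app_le A x : `|tensor_app A x| <= (\sum_J `|A J|) * `|x| ^+ m.-1.
Proof.
apply: row_norm_le => [|i]; first by rewrite mulr_ge0 ?exprn_ge0 ?sumr_ge0.
rewrite mxE (le_trans (ler_norm_sum _ _ _)) // mulr_suml.
rewrite [leRHS](bigID (fun J : m.-tuple 'I_n => ohead J == Some i)) /=.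
rewrite -[leLHS]addr0 lerD //; last first.
  by rewrite sumr_ge0 // => J _; rewrite mulr_ge0 ?exprn_ge0.
apply: ler_sum => J _; rewrite normrM ler_wpM2l // normr_prod.
have := size_behead J; rewrite size_tuple => <-.
elim: (behead J) => [|j s IH] /=; first by rewrite big_nil expr0.
by rewrite big_cons exprS ler_pM ?norm_coord_le // prodr_ge0.
Qed.

Lemma continuous_tensor_app (T : topologicalType) A (g : T -> 'rV[R]_n) z :
  {for z, continuous g} -> {for z, continuous (fun v => tensor_app A (g v))}.
Proof.
move=> gz; apply: continuous_row => i.
have -> : (fun v => tensor_app A (g v) 0 i) =
   fun v => \sum_(J : m.-tuple 'I_n | ohead J == Some i)
     A J * \prod_(j <- behead J) g v 0 j.
  by apply/funext => v; rewrite mxE.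
apply: continuous_sum => J _; apply: continuousM; first exact: cst_continuous.
by apply: continuous_prod => j _; apply: continuous_coord.
Qed.

End TensorApp.

(** * The homotopy defined by an H+ tensor *)

Section Homotopy.
Variables (R : realType) (n p : nat) (A : tensor R p n).
Hypotheses (p_gt1 : (1 < p)%N) (hA : Hplus_tensor A).

Local Notation powv := (tensor_app (unit_tensor R p n)).

(** [s] in [0, 1] parametrizes the half-line of the tensors [A + t *: I], up to
    positive factors; [s = 1] corresponds to [t = +oo]. *)
Definition homotopy (x : 'rV[R]_n) (s : R) : 'rV[R]_n :=
  (1 - s) *: tensor_app A x + s *: powv x.

Lemma continuous_homotopy (T : topologicalType) (g : T -> 'rV[R]_n) (s : T -> R) z :
  {for z, continuous g} -> {for z, continuous s} ->
  {for z, continuous (fun v => homotopy (g v) (s v))}.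
Proof.
move=> cg cs; rewrite /homotopy; apply: cvgD; apply: cvgZ => //.
- by apply: cvgB => //; apply: cvg_cst.
- exact: continuous_tensor_app.
- exact: continuous_tensor_app.
Qed.

Lemma homotopyZ c x s : homotopy (c *: x) s = c ^+ p.-1 *: homotopy x s.
Proof. by rewrite /homotopy !tensor_appZ scalerDr !scalerA ![_ * c ^+ _]mulrC. Qed.

Lemma powv_eq0 x : powv x = 0 -> x = 0.
Proof.
rewrite tensor_app_unit ?(ltnW p_gt1) // => /rowP h; apply/rowP => i.
by have := h i; rewrite !mxE => /eqP; rewrite expf_eq0 => /andP [_ /eqP].
Qed.

(** For [s < 1] the homotopy is, up to the factor [1 - s], the tensor
    [A + t *: I] with [t = s / (1 - s)]. *)
Lemma homotopy_neq0 x s : x != 0 -> 0 <= s <= 1 -> homotopy x s != 0.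
Proof.
move=> x0 /andP [s_ge0]; rewrite le_eqVlt => /orP [/eqP ->|s_lt1].
  rewrite /homotopy subrr scale0r add0r scale1r.
  by apply: contra_neq x0 => /powv_eq0.
have s1 : 1 - s != 0 by rewrite subr_eq0 gt_eqF.
apply: contra_not_neq hA => hx0; exists x, (s / (1 - s)); split=> //.
  by rewrite divr_ge0 // subr_ge0 ltW.
rewrite tensor_appD; apply: (scalerI s1).
by rewrite scaler0 scalerDr scalerA mulrCA divff // mulr1.
Qed.

(** The minimum over the compact set (unit sphere) x [0, 1] is positive, and
    homogeneity of degree [p.-1] extends the bound to all [x]. *)
Lemma homotopy_bounded_below : exists2 c, 0 < c &
  forall x s, 0 <= s <= 1 -> c * `|x| ^+ p.-1 <= `|homotopy x s|.
Proof.
pose S := [set x : 'rV[R]_n | `|x| = 1]; pose unit_itv := `[0 : R, 1]%classic.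
have [c c_gt0 hc] : exists2 c, 0 < c &
    forall x s, S x -> 0 <= s <= 1 -> c <= `|homotopy x s|.
  (* The sphere is empty when [n = 0]. *)
  have [S0|nS0] := pselect (S !=set0); last first.
    by exists 1 => // x s Sx; case: nS0; exists x.
  have cS : compact S.
    apply: bounded_closed_compact.
      exists 1; split=> // r r_gt1 x Sx; apply: le_trans (ltW r_gt1).
      by rewrite le_eqVlt (introT eqP Sx).
    apply: (@closed_comp _ _ (fun x : 'rV[R]_n => `|x|) [set 1]).
      by move=> x _; apply: norm_continuous.
    exact: closed_eq.
  pose f (xs : 'rV[R]_n * R) := `|homotopy xs.1 xs.2|.
  have cf : continuous f.
    move=> z; apply: (@continuous_comp _ _ _
      (fun xs => homotopy xs.1 xs.2) (fun y => `|y|)).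
      by apply: continuous_homotopy; [exact: cvg_fst|exact: cvg_snd].
    exact: norm_continuous.
  have ST0 : S `*` unit_itv !=set0.
    case: S0 => x Sx; exists (x, 0).
    by split; rewrite //= /unit_itv /= in_itv /= lexx ler01.
  have [[x s] /set_mem [/= Sx s01] xsmin] := compact_EVT_min ST0
    (compact_setX cS (@segment_compact R 0 1)) (continuous_subspaceT cf).
  exists (f (x, s)).
    rewrite normr_gt0; apply: homotopy_neq0; last first.
      by move: s01; rewrite /unit_itv /= in_itv.
    by rewrite -normr_gt0 Sx ltr01.
  move=> y t Sy t01; apply: (xsmin (y, t)); apply/mem_set; split=> //=.
exists c => // x s s01; have [->|x0] := eqVneq x 0.
  by rewrite normr0 expr0n; case: p p_gt1 => [|[|k]] //= _; rewrite mulr0.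
have nx_gt0 : 0 < `|x| by rewrite normr_gt0.
have xE : x = `|x| *: (`|x|^-1 *: x) by rewrite scalerA divff ?scale1r ?gt_eqF.
rewrite {2}xE homotopyZ normrZ normrX normr_id mulrC ler_wpM2l ?exprn_ge0 //.
apply: hc => //; rewrite /S /= normrZ normfV normr_id mulVf ?gt_eqF //.
Qed.

End Homotopy.

(** * Solutions of the equation *)

Section Solutions.
Variables (R : realType) (n p q : nat).
Variables (A : tensor R p n) (B : tensor R q n) (b : 'rV[R]_n).
Hypotheses (q_gt1 : (1 < q)%N) (qp : (q < p)%N) (hA : Hplus_tensor A).

Let p_gt1 : (1 < p)%N. Proof. exact: ltn_trans qp. Qed.

Local Notation powv := (tensor_app (unit_tensor R p n)).

Definition residual (x : 'rV[R]_n) := tensor_app A x + tensor_app B (abs_vec x) - b.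

Lemma continuous_abs_vec (T : topologicalType) (g : T -> 'rV[R]_n) z :
  {for z, continuous g} -> {for z, continuous (fun v => abs_vec (g v))}.
Proof.
move=> cg; apply: continuous_row => j.
have -> : (fun v => abs_vec (g v) 0 j) = (fun v => `|g v 0 j|).
  by apply/funext => v; rewrite mxE.
by apply: cvg_norm; apply: continuous_coord.
Qed.

Lemma continuous_residual (T : topologicalType) (g : T -> 'rV[R]_n) z :
  {for z, continuous g} -> {for z, continuous (fun v => residual (g v))}.
Proof.
move=> cg; apply: cvgB; last exact: cvg_cst.
apply: cvgD; first exact: continuous_tensor_app.
apply: (@continuous_tensor_app R q n T B (fun v => abs_vec (g v))).
exact: continuous_abs_vec.
Qed.

(** At a zero the homotopy equals [(1 - s) *: (b - B |x|^(q-1))], which grows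
    with exponent [q.-1 < p.-1] only, against a lower bound with exponent
    [p.-1]. *)
Lemma a_priori_bound : exists2 r, 0 <= r & forall x s, 0 <= s <= 1 ->
  (1 - s) *: residual x + s *: powv x = 0 -> `|x| <= r.
Proof.
have [c c_gt0 hc] := homotopy_bounded_below p_gt1 hA.
pose K := \sum_J `|B J|.
have K_ge0 : 0 <= K by apply: sumr_ge0.
exists (Num.max 1 ((K + `|b|) / c)); first by rewrite le_max ler01.
move=> x s s01 hx; rewrite le_max; have [//|x_gt1] := leP `|x| 1.
rewrite ler_pdivlMr //.
have x_gt0 : 0 < `|x| by apply: lt_trans x_gt1.
have homE : homotopy A x s = (1 - s) *: (b - tensor_app B (abs_vec x)).
  have splitA : tensor_app A x = residual x + (b - tensor_app B (abs_vec x)).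
    by rewrite /residual addrA subrK addrK.
  by rewrite /homotopy splitA scalerDr addrAC hx add0r.
have := hc x s s01; rewrite homE normrZ.
have -> : p.-1 = p.-2.+1 by case: p p_gt1 => [|[|]].
rewrite exprS mulrA => le1.
rewrite /= -(@ler_pM2r _ (`|x| ^+ p.-2)) ?exprn_gt0 // [`|x| * c]mulrC.
apply: le_trans le1 _; apply: (@le_trans _ _ `|b - tensor_app B (abs_vec x)|).
  by rewrite ler_piMl // ler_norml; case/andP: s01; lra.
apply: le_trans (ler_normB _ _) _; rewrite addrC mulrDl lerD //.
  apply: le_trans (tensor_app_le _ _) _; rewrite norm_abs_vec ler_wpM2l //.
  by rewrite ler_eXn2l //; move: qp; case: (p) => [|[|k]]; case: (q) => [|j].
by rewrite ler_peMr // exprn_ege1 // ltW.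
Qed.

Hypothesis p_even : ~~ odd p.

(** Were there no zero, the map [f] below, which sends [x] to the point of the
    sphere of radius [r] whose vector of powers is opposite to [residual x],
    would have a fixed point, a zero of the homotopy out of reach of the
    a priori bound. *)
Lemma residual_zero : exists x, residual x = 0.
Proof.
have [n0|n_gt0] := posnP n.
  by exists 0; move: (residual 0); rewrite n0 => y; apply: thinmx0.
have [r0 r0_ge0 hr0] := a_priori_bound; pose r := r0 + 1.
have r_gt0 : 0 < r by rewrite ltr_pwDr.
have k_odd : odd p.-1 by case: p p_gt1 p_even => //= k _; rewrite negbK.
apply: contrapT => /forallNP nz.
have F_gt0 x : 0 < `|residual x| by rewrite normr_gt0; apply/eqP.
pose scaled x i := - (r ^+ p.-1) * residual x 0 i / `|residual x|.
pose f x : 'rV[R]_n := \row_i odd_root p.-1 (scaled x i).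
have f_le x i : `|f x 0 i| <= r.
  rewrite mxE odd_root_le ?(ltW r_gt0) // /scaled !normrM normrN normfV normr_id.
  rewrite normrX (gtr0_norm r_gt0) -mulrA ler_piMr ?exprn_ge0 ?(ltW r_gt0) //.
  by rewrite ler_pdivrMr // mul1r norm_coord_le.
have cF (z : 'rV[R]_n) : {for z, continuous residual}.
  by apply: (@continuous_residual _ id); apply: cvg_id.
have cf : continuous f.
  move=> z; apply: continuous_row => i.
  have -> : (fun v => f v 0 i) = odd_root p.-1 \o (fun v => scaled v i).
    by apply/funext => v; rewrite mxE.
  apply: continuous_comp; last exact: continuous_odd_root.
  by apply: continuous_unit_coord => //; apply/eqP.
have [x fx] := bounded_map_fixpoint n_gt0 r_gt0 f_le cf.
have xE i : x 0 i ^+ p.-1 = scaled x i by rewrite -{1}fx mxE odd_rootK.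
pose a := r ^+ p.-1 / `|residual x|.
have a_ge0 : 0 <= a by rewrite divr_ge0 ?exprn_ge0 ?(ltW r_gt0).
have powE : powv x = - a *: residual x.
  rewrite tensor_app_unit ?(ltnW p_gt1) //; apply/rowP => i.
  by rewrite [LHS]mxE [RHS]mxE xE /scaled /a !mulNr mulrAC.
have a1_gt0 : 0 < 1 + a by rewrite ltr_pwDl.
(* [powv x = - a *: residual x] makes the homotopy vanish at [s = 1 / (1 + a)]. *)
have x_le : `|x| <= r0.
  apply: (hr0 x (1 + a)^-1).
    by rewrite invr_ge0 (ltW a1_gt0) /= invf_le1 // lerDl.
  rewrite powE scalerA -scalerDl.
  have -> : 1 - (1 + a)^-1 + (1 + a)^-1 * - a = 0 by field; rewrite gt_eqF.
  by rewrite scale0r.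
have [i Fi] := row_norm_attained (introN eqP (nz x)).
have : `|x 0 i| ^+ p.-1 = r ^+ p.-1.
  rewrite -normrX xE /scaled !normrM normrN normfV normr_id Fi.
  by rewrite mulfK ?gt_eqF // normrX (gtr0_norm r_gt0).
move=> /eqP; rewrite eqrXn2 ?(ltW r_gt0) //; last by case: p p_gt1 => [|[|]].
move=> /eqP xr; have := norm_coord_le x i; rewrite xr.
by rewrite leNgt (le_lt_trans x_le) // ltrDl.
Qed.

Lemma compact_zeros : compact [set x | residual x = 0].
Proof.
have [r r_ge0 hr] := a_priori_bound.
apply: bounded_closed_compact.
  exists r; split; first exact: num_real.
  move=> t rt x x0; apply: le_trans (ltW rt).
  apply: (hr x 0); first by rewrite lexx ler01.
  by rewrite scale0r addr0 (x0 : residual x = 0) scaler0.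
apply: (@closed_comp _ _ residual [set 0]); last first.
  exact/accessible_closed_set1/hausdorff_accessible/norm_hausdorff.
by move=> x _; apply: (@continuous_residual _ id); apply: cvg_id.
Qed.

End Solutions.

Theorem theorem3p4 (R : realType) (n p q : nat)
    (A : tensor R p n) (B : tensor R q n)
    (hp : ~~ odd p) (hqp : (q < p)%N) (hq : (2 <= q)%N)
    (hA : Hplus_tensor A) (b : 'rV[R]_n) :
  SOL A B b !=set0 /\ compact (SOL A B b).
Proof.
have -> : SOL A B b = [set x | residual A B b x = 0].
  apply/seteqP; split=> x; last exact: subr0_eq.
  by rewrite /SOL /residual /= => ->; rewrite subrr.
split; last exact: compact_zeros.
by have [x hx] := residual_zero B b hq hqp hA hp; exists x.
Qed.
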